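(* Let $F$ be a rational map, and suppose there exist a bicritical rational map $f$ of degree $d\ge3$ and $k\in\mathbb{N}$ with $f^k=F$. Then every element of $\mathrm{Deck}(F)$ of order at least $3$ has fixed point set exactly $\mathcal{C}_f$ (and such elements exist), and $$\mathcal{V}_f = \{x\in\hat{\mathbb{C}} : F^{-1}(x)\subseteq \mathcal{C}_F\}.$$
   Context: A rational map of degree $d\ge2$ is bicritical if it has exactly two critical points. $\mathcal{C}_h$ denotes the set of critical points of a rational map $h$ and $\mathcal{V}_h$ its set of critical values. $\mathrm{Deck}(F)=\{\tau \text{ Möbius} : F\circ\tau=F\}$. *)

(* Defs.v *)
From HB Require Import structures.
From mathcomp Require Import all_boot all_order all_algebra.
From mathcomp Require Import reals complex.
Set Implicit Arguments. Unset Strict Implicit. Unset Printing Implicit Defensive.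
Import Order.TTheory GRing.Theory Num.Theory.
Local Open Scope ring_scope.

(* The complex numbers are modelled as R[i] for an arbitrary R : realType
   (every realType is isomorphic to the reals).  The Riemann sphere
   \hat C is  option C  with  None = infinity. *)

Section RatMaps.
Variable C : fieldType.

Definition sphere := option C.

Record ratmap := RatMap { num : {poly C}; den : {poly C}; coprime_nd : coprimep num den }.

Definition rdeg (F : ratmap) : nat := (maxn (size (num F)) (size (den F))).-1.

Definition reval (F : ratmap) (z : sphere) : sphere :=
  match z with
  | Some x => if (den F).[x] != 0 then Some ((num F).[x] / (den F).[x]) else None
  | None =>
      if (size (den F) < size (num F))%N then None
      else if size (den F) == size (num F)
           then Some (lead_coef (num F) / lead_coef (den F))
           else Some 0
  end.

(* w^d p(1/w) : the polynomial in the chart w = 1/z at infinity *)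
Definition homrev (d : nat) (p : {poly C}) : {poly C} :=
  'X^(d.+1 - size p) * Poly (rev p).

(* Wronskian p'q - pq' : in local coordinates the derivative of p/q
   (resp. of q/p) is W/q^2 (resp. -W/p^2) *)
Definition wronsk (p q : {poly C}) : {poly C} := p^`() * q - p * q^`().

(* critical points: points where the derivative in local coordinates
   (on source and target) vanishes; the chart at infinity is w = 1/z. *)
Definition is_crit (F : ratmap) (z : sphere) : Prop :=
  match z with
  | Some x => root (wronsk (num F) (den F)) x
  | None => root (wronsk (homrev (rdeg F) (num F)) (homrev (rdeg F) (den F))) 0
  end.

Definition is_critval (F : ratmap) (v : sphere) : Prop :=
  exists2 z, is_crit F z & reval F z = v.

Definition bicritical (F : ratmap) : Prop :=
  exists a b : sphere, a <> b /\ forall z, is_crit F z <-> (z = a \/ z = b).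

Definition mobius (a b c d : C) (z : sphere) : sphere :=
  match z with
  | Some x => if c * x + d != 0 then Some ((a * x + b) / (c * x + d)) else None
  | None => if c != 0 then Some (a / c) else None
  end.

Definition is_mobius (tau : sphere -> sphere) : Prop :=
  exists a b c d : C, a * d - b * c != 0 /\ forall z, tau z = mobius a b c d z.

Definition in_deck (F : ratmap) (tau : sphere -> sphere) : Prop :=
  is_mobius tau /\ forall z, reval F (tau z) = reval F z.

Definition order_ge3 (tau : sphere -> sphere) : Prop :=
  (exists z, tau z <> z) /\ (exists z, tau (tau z) <> z).

End RatMaps.

(* Main.v *)
Require Import Defs.
From HB Require Import structures.
From mathcomp Require Import all_boot all_order all_algebra all_fingroup.
From mathcomp Require Import cyclotomic separable boolp.
From mathcomp Require Import reals complex.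
From mathcomp Require Import ring zify.
Set Implicit Arguments. Unset Strict Implicit. Unset Printing Implicit Defensive.
Import Order.TTheory GRing.Theory Num.Theory.

(** Since [f] is bicritical, a Wronskian computation gives [f = M2 o z^d o M1^-1] with
[M1], [M2] Moebius, so the critical points [a], [b] and the critical values have a single
preimage each, while every other fibre has [d] points. Pulling back a non-critical value
while avoiding [V_f], which is possible because [d >= 3], gives the description of [V_f].

The group [Deck F] acts freely on generic fibres of [F], so it is finite of order dividing
[d^k]; it contains the rotations of order [d] about the axis [{a, b}]. Counting fixed
points (every nontrivial element has exactly two) over the orbits of this group shows
that [{a, b}] is invariant: otherwise the group would be tetrahedral, octahedral or
icosahedral, and then some prime dividing its order would fail to divide [d]. A Moebius
map preserving [{a, b}] either swaps the two points, hence is an involution, or fixes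
both. *)

Local Open Scope ring_scope.

(** * Homogeneous coordinates and Moebius maps *)

Section Points.
Variable C : fieldType.

Definition nz (x y : C) := (x != 0) || (y != 0).

(** The point [x : y] of the projective line; homogeneous coordinates avoid case splits at
    infinity. *)
Definition pt (x y : C) : sphere C := if y != 0 then Some (x / y) else None.

Lemma pt_eqP x y x' y' : nz x y -> nz x' y' ->
  pt x y = pt x' y' <-> x * y' = x' * y.
Proof.
rewrite /nz /pt; case: (eqVneq y 0) => [->|y0]; case: (eqVneq y' 0) => [->|y'0] /=;
  rewrite ?orbF ?orbT => hx hx'; split => //; rewrite ?mulr0 //.
- by move=> /eqP; rewrite mulf_eq0 (negPf hx) (negPf y'0).
- by move=> /eqP; rewrite eq_sym mulf_eq0 (negPf hx') (negPf y0).
- by move=> [e]; apply/eqP; rewrite -eqr_div //; apply/eqP.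
- by move=> e; congr Some; apply/eqP; rewrite eqr_div //; apply/eqP.
Qed.

Lemma pt1 x : pt x 1 = Some x.
Proof. by rewrite /pt oner_eq0 divr1. Qed.

Lemma pt0 x : pt x 0 = None.
Proof. by rewrite /pt eqxx. Qed.

Lemma nz1 x : nz x 1.
Proof. by rewrite /nz oner_eq0 orbT. Qed.

Lemma nz_inf : nz 1 0.
Proof. by rewrite /nz oner_eq0. Qed.

Lemma ptP (z : sphere C) : exists x y, nz x y /\ z = pt x y.
Proof.
case: z => [x|]; first by exists x, 1; rewrite nz1 pt1.
by exists 1, 0; rewrite nz_inf pt0.
Qed.

Lemma nz_lin a b c d x y : a * d - b * c != 0 -> nz x y ->
  nz (a * x + b * y) (c * x + d * y).
Proof.
move=> D; rewrite /nz -!negb_and; apply: contra => /andP[/eqP e1 /eqP e2].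
(* The adjugate matrix recovers (x, y) from its image, up to the determinant. *)
have ex : (a * d - b * c) * x = d * (a * x + b * y) - b * (c * x + d * y) by ring.
have ey : (a * d - b * c) * y = a * (c * x + d * y) - c * (a * x + b * y) by ring.
move: ex ey; rewrite e1 e2 !mulr0 subrr => /eqP + /eqP.
by rewrite !mulf_eq0 (negPf D) /= => -> ->.
Qed.

Lemma mobius_pt a b c d x y : a * d - b * c != 0 -> nz x y ->
  mobius a b c d (pt x y) = pt (a * x + b * y) (c * x + d * y).
Proof.
move=> D; rewrite /nz /pt; case: (eqVneq y 0) => [->|y0] /=.
  rewrite orbF !mulr0 !addr0 => x0; rewrite mulf_eq0 (negPf x0) orbF.
  by case: eqVneq => //= c0; rewrite -mulf_div divff // mulr1.
move=> _; have -> : c * (x / y) + d = (c * x + d * y) / y by field.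
rewrite mulf_eq0 invr_eq0 (negPf y0) orbF; case: eqVneq => //= e.
by congr Some; field; rewrite e y0.
Qed.

Lemma mobius_id z : @mobius C 1 0 0 1 z = z.
Proof.
by case: z => [x|] /=; rewrite ?mul0r ?add0r ?oner_eq0 ?eqxx //= mul1r addr0 divr1.
Qed.

Lemma is_mobius_id : is_mobius (fun z : sphere C => z).
Proof.
exists 1, 0, 0, 1; split=> [|z]; last by rewrite mobius_id.
by rewrite mulr1 mul0r subr0 oner_eq0.
Qed.

Lemma is_mobius_comp (s t : sphere C -> sphere C) :
  is_mobius s -> is_mobius t -> is_mobius (fun z => s (t z)).
Proof.
move=> [a [b [c [d [D e]]]]] [a' [b' [c' [d' [D' e']]]]].
exists (a * a' + b * c'), (a * b' + b * d'), (c * a' + d * c'), (c * b' + d * d').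
have DD : (a * a' + b * c') * (c * b' + d * d') - (a * b' + b * d') * (c * a' + d * c')
   = (a * d - b * c) * (a' * d' - b' * c') by ring.
have DD0 : (a * a' + b * c') * (c * b' + d * d') - (a * b' + b * d') * (c * a' + d * c') != 0.
  by rewrite DD mulf_neq0.
split=> // z; have [x [y [h ->]]] := ptP z.
rewrite e e' mobius_pt // mobius_pt ?nz_lin // mobius_pt //.
by congr pt; ring.
Qed.

Lemma is_mobius_inv (s : sphere C -> sphere C) : is_mobius s ->
  exists t, [/\ is_mobius t, cancel s t & cancel t s].
Proof.
move=> [a [b [c [d [D e]]]]].
have D' : d * a - (- b) * (- c) != 0 by rewrite mulrNN mulrC.
exists (mobius d (- b) (- c) a); split; first by exists d, (- b), (- c), a.
  move=> z; have [x [y [h ->]]] := ptP z.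
  rewrite e mobius_pt // mobius_pt ?nz_lin //; apply/pt_eqP; rewrite ?nz_lin //; ring.
move=> z; have [x [y [h ->]]] := ptP z.
rewrite e mobius_pt // mobius_pt ?nz_lin //; apply/pt_eqP; rewrite ?nz_lin //; ring.
Qed.

Lemma is_mobius_iter (s : sphere C -> sphere C) n : is_mobius s -> is_mobius (iter n s).
Proof.
by move=> hs; elim: n => [|n IH] /=; [exact: is_mobius_id|exact: is_mobius_comp].
Qed.

Lemma is_mobius_inj (s : sphere C -> sphere C) : is_mobius s -> injective s.
Proof. by move=> /is_mobius_inv[t [_ k _]]; apply: can_inj k. Qed.

(** The columns of the matrix are homogeneous coordinates of [b] and [a]; distinctness of the points
    is non-vanishing of the determinant. *)
Lemma frame_exists (a b : sphere C) : a <> b ->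
  exists m11 m12 m21 m22 : C, [/\ m11 * m22 - m12 * m21 != 0,
    mobius m11 m12 m21 m22 (Some 0) = a & mobius m11 m12 m21 m22 None = b].
Proof.
have [x [y [h ->]]] := ptP a; have [x' [y' [h' ->]]] := ptP b => ne.
have D : x' * y - x * y' != 0.
  by apply/eqP => /eqP; rewrite subr_eq0 => /eqP e; apply: ne; apply/pt_eqP.
exists x', x, y', y; split => //.
by rewrite -pt1 mobius_pt ?nz1 // !mulr0 !add0r !mulr1.
Qed.

(** Moves two chosen points to 0 and infinity, where fixing or swapping them can be read off from
    the coefficients of the conjugate [t]. *)
Lemma conj_mobius (s : sphere C -> sphere C) (a b : sphere C) : a <> b -> is_mobius s ->
  exists m t, [/\ is_mobius m, m (Some 0) = a, m None = b, is_mobius t & forall z, s (m z) = m (t z)].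
Proof.
move=> ab hs; have [p [q [r [u [D ea eb]]]]] := frame_exists ab.
have hm : is_mobius (mobius p q r u) by exists p, q, r, u.
have [mi [hi k1 k2]] := is_mobius_inv hm.
exists (mobius p q r u), (fun z => mi (s (mobius p q r u z))); split=> //.
  by apply: is_mobius_comp => //; apply: is_mobius_comp.
Qed.

Lemma mobius_fix_inf (s : sphere C -> sphere C) : is_mobius s -> s None = None ->
  exists a b, a != 0 /\ forall x, s (Some x) = Some (a * x + b).
Proof.
move=> [a [b [c [d [D e]]]]]; rewrite e /=; case: eqVneq => // c0 _.
move: D; rewrite c0 mulr0 subr0 mulf_eq0 negb_or => /andP[a0 d0].
exists (a / d), (b / d); split; first by rewrite mulf_neq0 ?invr_eq0.
by move=> x; rewrite e /= c0 mul0r add0r d0; congr Some; field.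
Qed.

(** With two fixed points placed at 0 and infinity the map is a scaling, and a third fixed point
    makes its factor 1. *)
Lemma mobius_fix3 (s : sphere C -> sphere C) x y z : is_mobius s ->
  x <> y -> x <> z -> y <> z -> s x = x -> s y = y -> s z = z -> forall w, s w = w.
Proof.
move=> hs xy xz yz sx sy sz.
have [m [t [hm m0 mi ht e]]] := conj_mobius xy hs.
have inj := is_mobius_inj hm.
have [mi' [_ k1 k2]] := is_mobius_inv hm.
have ti : t None = None by apply: inj; rewrite -e mi sy.
have [a [b [a0 h]]] := mobius_fix_inf ht ti.
have t0 : t (Some 0) = Some 0 by apply: inj; rewrite -e m0 sx.
move: t0; rewrite h mulr0 add0r => -[b0].
have tz : t (mi' z) = mi' z by apply: inj; rewrite -e k2 sz.
case E: (mi' z) tz => [u|].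
  rewrite h b0 addr0 => -[eu].
  have u0 : u != 0 by apply/eqP => u0; apply: xz; rewrite -m0 -u0 -E k2.
  have a1 : a = 1 by apply: (mulIf u0); rewrite mul1r.
  move=> w; rewrite -(k2 w) e; congr m; case: (mi' w) => [v|//].
  by rewrite h a1 b0 mul1r addr0.
by case: yz; rewrite -mi -E k2.
Qed.

Lemma mobius_eq3 (s t : sphere C -> sphere C) x y z : is_mobius s -> is_mobius t ->
  x <> y -> x <> z -> y <> z -> s x = t x -> s y = t y -> s z = t z -> s =1 t.
Proof.
move=> hs ht xy xz yz ex ey ez w.
have [ti [hti k1 k2]] := is_mobius_inv ht.
have h := @mobius_fix3 (fun z => ti (s z)) x y z.
rewrite -[LHS]k2; congr t; apply: (h) => //; first exact: is_mobius_comp.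
- by rewrite ex k1.
- by rewrite ey k1.
- by rewrite ez k1.
Qed.

(** With the swapped points at 0 and infinity the map has the form b / (c z), which is an
    involution. *)
Lemma mobius_swap (s : sphere C -> sphere C) x y : is_mobius s ->
  x <> y -> s x = y -> s y = x -> forall w, s (s w) = w.
Proof.
move=> hs xy sx sy.
have [m [t [hm m0 mi ht e]]] := conj_mobius xy hs.
have inj := is_mobius_inj hm.
have [mi' [_ k1 k2]] := is_mobius_inv hm.
have t0 : t (Some 0) = None by apply: inj; rewrite -e m0 sx mi.
have ti : t None = Some 0 by apply: inj; rewrite -e mi sy m0.
suff tt v : t (t v) = v by move=> w; rewrite -(k2 w) e e tt.
have [a [b [c [d [D et]]]]] := ht.
have d0 : d = 0 by apply/eqP; move: t0; rewrite et /= mulr0 add0r; case: eqP.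
have a0 : a = 0.
  move: ti; rewrite et /=; case: eqVneq => //= c0 -[] /eqP.
  by rewrite mulf_eq0 invr_eq0 (negPf c0) orbF => /eqP.
case: v => [v|]; last by rewrite ti t0.
have [->|v0] := eqVneq v 0; first by rewrite t0 ti.
move: D; rewrite a0 mul0r sub0r oppr_eq0 mulf_eq0 negb_or => /andP[b0 c0].
rewrite !et /= a0 d0 !mul0r !addr0 !add0r mulf_neq0 //= addr0.
rewrite mulf_neq0 //; last by rewrite mulf_neq0 // invr_eq0 mulf_neq0.
by congr Some; field; rewrite b0 v0 c0.
Qed.

End Points.

Lemma mobius_has_fixpoint (C : numClosedFieldType) (s : sphere C -> sphere C) :
  is_mobius s -> exists p, s p = p.
Proof.
move=> [a [b [c [d [D e]]]]].
have [c0|c0] := eqVneq c 0; first by exists None; rewrite e /= c0 eqxx.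
pose D' := sqrtC ((a - d) ^+ 2 + 4%:R * b * c).
pose x := (a - d + D') / (2%:R * c).
have two : (2%:R : C) != 0 by rewrite pnatr_eq0.
have hx : x * (c * x + d) = a * x + b.
  apply/eqP; rewrite -subr_eq0; apply/eqP.
  have -> : x * (c * x + d) - (a * x + b) = (D' ^+ 2 - (a - d)^+2 - 4%:R * b * c) / (4%:R * c).
    by rewrite /x; field; rewrite c0 ?two.
  by rewrite /D' sqrtCK [X in X / _](_ : _ = 0) ?mul0r //; ring.
(* A root with [c * x + d = 0] would also satisfy [a * x + b = 0], so the determinant would
   vanish. *)
have nd : c * x + d != 0.
  apply: contra D => /eqP h; rewrite h mulr0 in hx.
  have : c * (a * x + b) = 0 by rewrite -hx mulr0.
  have -> : c * (a * x + b) = a * (c * x + d) - (a * d - b * c) by ring.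
  by rewrite h mulr0 sub0r => /eqP; rewrite oppr_eq0.
by exists (Some x); rewrite e /= nd -hx mulfK.
Qed.

(** One fixed point exists; at infinity it makes the map affine, a x + b. If a differs from 1, the
    second fixed point is b / (1 - a). A translation has finite order in characteristic 0 only if it
    is the identity. *)
Lemma mobius_torsion_fix2 (C : numClosedFieldType) (s : sphere C -> sphere C) n :
  is_mobius s -> (forall z, iter n.+1 s z = z) -> (exists z, s z <> z) ->
  exists x y, [/\ x <> y, s x = x & s y = y].
Proof.
move=> hs hn [z0 hz0].
have [p hp] := mobius_has_fixpoint hs.
have pz : z0 <> p by move=> h; rewrite h in hz0.
have [m [t [hm m0 mi ht e]]] := conj_mobius pz hs.
have inj := is_mobius_inj hm.
have ti : t None = None by apply: inj; rewrite -e mi hp.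
have [a [b [a0 h]]] := mobius_fix_inf ht ti.
have [a1|a1] := eqVneq a 1; last first.
  exists p, (m (Some (b / (1 - a)))); split => //.
    by rewrite -mi => /inj.
  rewrite e h; congr (m (Some _)); field.
  by rewrite subr_eq0 eq_sym a1.
have it j : iter j t (Some 0) = Some (b *+ j).
  elim: j => //= j ->; by rewrite h a1 mul1r mulrSr.
have ei j z : iter j s (m z) = m (iter j t z) by elim: j => //= j ->; rewrite e.
have : Some (b *+ n.+1) = Some 0 by rewrite -it; apply: inj; rewrite -ei hn.
move=> [] /eqP; rewrite mulrn_eq0 /= => /eqP b0.
case: hz0; rewrite -m0 e h a1 b0; congr (m (Some _)); ring.
Qed.

(** * Binary forms and ramification *)

Section Forms.

(** A binary form of degree [n]. The base is a general commutative ring so that the form can be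
    evaluated at scalars and also at pairs of polynomials, that is, along curves. *)
Definition hform (S : comNzRingType) n (c : nat -> S) (x y : S) : S :=
  \sum_(i < n.+1) c i * x ^+ i * y ^+ (n - i).

(* Index shift: [hformX n c] and [hformY n c] are the partial derivatives of [hform n.+1 c]. *)
Definition hformX (S : comNzRingType) n (c : nat -> S) (x y : S) : S :=
  hform n (fun i => c i.+1 *+ i.+1) x y.

Definition hformY (S : comNzRingType) n (c : nat -> S) (x y : S) : S :=
  hform n (fun i => c i *+ (n.+1 - i)) x y.

Definition jac (S : comNzRingType) n (c e : nat -> S) (x y : S) : S :=
  hformX n c x y * hformY n e x y - hformY n c x y * hformX n e x y.

Section Ring.
Variable S : comNzRingType.
Implicit Types (c e : nat -> S) (x y l : S).

Lemma eq_hform n c e x y : c =1 e -> hform n c x y = hform n e x y.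
Proof. by move=> h; apply: eq_bigr => i _; rewrite h. Qed.

Lemma hformZ n c l x y : hform n c (l * x) (l * y) = l ^+ n * hform n c x y.
Proof.
rewrite /hform mulr_sumr; apply: eq_bigr => i _.
have -> : l ^+ n = l ^+ i * l ^+ (n - i) by rewrite -exprD subnKC // -ltnS.
by rewrite !exprMn; ring.
Qed.

Lemma jacZ n c e l x y : jac n c e (l * x) (l * y) = l ^+ (n + n) * jac n c e x y.
Proof. by rewrite /jac /hformX /hformY !hformZ exprD; ring. Qed.

Lemma hform_y0 n c x : hform n c x 0 = c n * x ^+ n.
Proof.
rewrite /hform big_ord_recr /= subnn expr0 mulr1 big1 ?add0r // => i _.
by rewrite expr0n subn_eq0 leqNgt ltn_ord mulr0.
Qed.

Lemma hform_euler n c x y :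
  hform n.+1 c x y *+ n.+1 = x * hformX n c x y + y * hformY n c x y.
Proof.
transitivity (\sum_(i < n.+2) (c i * x ^+ i * y ^+ (n.+1 - i)) *+ i
    + \sum_(i < n.+2) (c i * x ^+ i * y ^+ (n.+1 - i)) *+ (n.+1 - i)).
  rewrite -big_split /= -sumrMnl; apply: eq_bigr => i _.
  by rewrite -mulrnDr subnKC // -ltnS.
congr (_ + _).
  rewrite big_ord_recl mulr0n add0r /hformX /hform mulr_sumr; apply: eq_bigr => i _.
  by rewrite lift0 subSS exprS -!mulrnAl; ring.
rewrite big_ord_recr /= subnn mulr0n addr0 /hformY /hform mulr_sumr.
apply: eq_bigr => i _ /=.
rewrite subSn; last by rewrite -ltnS.
by rewrite exprS -!mulrnAl; ring.
Qed.

End Ring.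

Section Poly.
Variable C : fieldType.
Implicit Types (c e : nat -> C) (A B p q : {poly C}).

Definition cst c : nat -> {poly C} := fun i => (c i)%:P.

Lemma horner_hform n c A B t :
  (hform n (cst c) A B).[t] = hform n c A.[t] B.[t].
Proof.
rewrite /hform horner_sum; apply: eq_bigr => i _.
by rewrite !hornerM !horner_exp hornerC.
Qed.

Lemma hformX_cst n c A B :
  hformX n (cst c) A B = hform n (cst (fun i => c i.+1 *+ i.+1)) A B.
Proof. by apply: eq_hform => i; rewrite /cst polyCMn. Qed.

Lemma hformY_cst n c A B :
  hformY n (cst c) A B = hform n (cst (fun i => c i *+ (n.+1 - i))) A B.
Proof. by apply: eq_hform => i; rewrite /cst polyCMn. Qed.

Lemma horner_jac n c e A B t :
  (jac n (cst c) (cst e) A B).[t] = jac n c e A.[t] B.[t].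
Proof. by rewrite /jac !hformX_cst !hformY_cst hornerD hornerN !hornerM !horner_hform. Qed.

Lemma deriv_hform n c A B :
  (hform n.+1 (cst c) A B)^`() =
  hformX n (cst c) A B * A^`() + hformY n (cst c) A B * B^`().
Proof.
rewrite /hform raddf_sum /=.
transitivity (\sum_(i < n.+2) cst c i * (A ^+ i)^`() * B ^+ (n.+1 - i)
    + \sum_(i < n.+2) cst c i * A ^+ i * (B ^+ (n.+1 - i))^`()).
  rewrite -big_split /=; apply: eq_bigr => i _.
  by rewrite !derivM derivC; ring.
congr (_ + _).
  rewrite big_ord_recl expr0 -polyC1 derivC mulr0 mul0r add0r /hformX /hform mulr_suml.
  apply: eq_bigr => i _.
  rewrite lift0 subSS deriv_exp /= -!mulrnAl; ring.
rewrite big_ord_recr /= subnn expr0 -polyC1 derivC mulr0 addr0 /hformY /hform mulr_suml.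
apply: eq_bigr => i _ /=.
rewrite subSn; last by rewrite -ltnS.
by rewrite deriv_exp /= -!mulrnAl; ring.
Qed.

(* Chain rule for ramification: by Euler's identity the Wronskian of the image curve is,
   up to the degree, the Jacobian times the Wronskian of the curve. *)
Lemma wronsk_hform n c e A B :
  wronsk (hform n.+1 (cst c) A B) (hform n.+1 (cst e) A B) *+ n.+1 =
  jac n (cst c) (cst e) A B * wronsk A B.
Proof.
rewrite /wronsk mulrnBl -mulrnAr -mulrnAl !hform_euler !deriv_hform /jac; ring.
Qed.

Lemma poly_sum n p : (size p <= n.+1)%N -> p = \sum_(i < n.+1) p`_i *: 'X^i.
Proof.
move=> sp; rewrite -poly_def; apply/polyP => i; rewrite coef_poly.
by case: ltnP => // h; rewrite nth_default // (leq_trans sp).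
Qed.

(** This lemma and the next identify a form along the charts at a finite point and at infinity with
    the polynomials used in [is_crit]. *)
Lemma hform_shift n p x : (size p <= n.+1)%N ->
  hform n (cst (nth 0 p)) ('X + x%:P) 1 = p \Po ('X + x%:P).
Proof.
move=> sp; rewrite {2}(poly_sum sp) raddf_sum /=; apply: eq_bigr => i _.
by rewrite expr1n mulr1 comp_polyZ comp_Xn_poly -mul_polyC.
Qed.

Lemma hform_homrev n p : (size p <= n.+1)%N ->
  hform n (cst (nth 0 p)) 1 'X = homrev n p.
Proof.
move=> sp; transitivity (\poly_(i < n.+1) p`_(n - i)).
  rewrite poly_def /hform (reindex_inj rev_ord_inj) /=; apply: eq_bigr => i _.
  rewrite expr1n mulr1 subSS subKn; last by rewrite -ltnS.
  by rewrite -mul_polyC.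
apply/polyP => j; rewrite coef_poly /homrev coefXnM coef_Poly.
have [s es] : exists s, s = size p by exists (size p).
rewrite -!es in sp *.
case: (ltnP j n.+1) => hj.
  case: (ltnP j (n.+1 - s)) => hs; first by rewrite nth_default // -es; lia.
  rewrite nth_rev -?es; last by lia.
  by have -> : (s - (j - (n.+1 - s)).+1)%N = (n - j)%N by lia.
case: (ltnP j (n.+1 - s)) => // hs.
by rewrite nth_default // size_rev -es; lia.
Qed.

Lemma horner_ratio n p x y : (size p <= n.+1)%N -> y != 0 ->
  hform n (nth 0 p) x y = y ^+ n * p.[x / y].
Proof.
move=> sp y0; rewrite (horner_coef_wide _ sp) mulr_sumr; apply: eq_bigr => i _.
have -> : y ^+ n = y ^+ i * y ^+ (n - i) by rewrite -exprD subnKC // -ltnS.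
rewrite expr_div_n; field.
by rewrite expf_neq0.
Qed.

(** Both pairs represent the same function, whose derivative is W / B^2 (and -W / A^2 for the
    reciprocal). The cross-multiplied form holds even where denominators vanish. *)
Lemma wronsk_proportional A B A2 B2 : A * B2 = A2 * B ->
  wronsk A B * B2 ^+ 2 = wronsk A2 B2 * B ^+ 2 /\
  wronsk A B * A2 ^+ 2 = wronsk A2 B2 * A ^+ 2.
Proof.
move=> e.
have d : A^`() * B2 + A * B2^`() = A2^`() * B + A2 * B^`() by rewrite -!derivM e.
have d1 : A^`() * B2 = A2^`() * B + A2 * B^`() - A * B2^`() by rewrite -d addrK.
have d2 : A2 * B^`() = A^`() * B2 + A * B2^`() - A2^`() * B by rewrite d; ring.
rewrite /wronsk; split.
- transitivity (B * B2 * (A^`() * B2) - B^`() * B2 * (A * B2)); first by ring.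
  rewrite e d1.
  transitivity (B * B2 * (A2^`() * B) - B * B2^`() * (A * B2)); first by ring.
  by rewrite e; ring.
- transitivity (A^`() * A2 * (A2 * B) - A * A2 * (A2 * B^`())); first by ring.
  rewrite -e d2.
  transitivity (A * A2^`() * (A2 * B) - A ^+ 2 * (A2 * B2^`())); first by ring.
  by rewrite -e; ring.
Qed.

(** Ramification at 0 depends only on the curve in the projective line, not on the pair of
    polynomials representing it. *)
Lemma wronsk_germ A B A2 B2 : A * B2 = A2 * B ->
  nz A.[0] B.[0] -> nz A2.[0] B2.[0] ->
  root (wronsk A B) 0 = root (wronsk A2 B2) 0.
Proof.
move=> e n1 n2; have [e1 e2] := wronsk_proportional e.
have key (w w2 x y : C) : x != 0 -> y != 0 -> w * x ^+ 2 = w2 * y ^+ 2 ->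
    (w == 0) = (w2 == 0).
  move=> x0 y0 /(congr1 (eq_op^~ 0)).
  by rewrite !mulf_eq0 (negPf x0) (negPf y0) !orbF.
move: (congr1 (horner^~ 0) e) (congr1 (horner^~ 0) e1) (congr1 (horner^~ 0) e2).
rewrite !hornerM /root => h h1 h2.
(* Both pairs give the same point at 0, so some affine chart of the target contains it for both. *)
have : (B.[0] != 0) && (B2.[0] != 0) || (A.[0] != 0) && (A2.[0] != 0).
  move: n1 n2 h; rewrite /nz.
  have [->|a] := eqVneq A.[0] 0; have [->|b] := eqVneq B.[0] 0 => //=;
  have [->|a2] := eqVneq A2.[0] 0; have [->|b2] := eqVneq B2.[0] 0 => //= _ _ /eqP.
  - by rewrite mul0r eq_sym mulf_eq0 (negPf a2) (negPf b).
  - by rewrite mulr0 mulf_eq0 (negPf a) (negPf b2).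
by case/orP => /andP[u v]; [apply: key h1|apply: key h2].
Qed.

End Poly.
End Forms.

(** * Critical points of iterates via the chain rule along curves *)

Section Crit.
Variable C : numFieldType.
Implicit Types (F f : ratmap C) (A B : {poly C} * {poly C}) (p q : {poly C}) (z : sphere C).

Lemma poly_eq_fun p q : (forall t, p.[t] = q.[t]) -> p = q.
Proof.
move=> h; apply/eqP; rewrite -subr_eq0; apply/negPn/negP => r0.
have := max_poly_roots r0 (rs := [seq i%:R | i <- iota 0 (size (p - q))]).
rewrite size_map size_iota ltnn => H; suff: false by []; apply: H.
- by apply/allP => _ /mapP[i _ ->]; rewrite /root hornerD hornerN h subrr.
- by rewrite map_inj_uniq ?iota_uniq // => i j /eqP; rewrite eqr_nat => /eqP.
Qed.

Lemma size_num F : (size (num F) <= (rdeg F).+1)%N.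
Proof. by rewrite /rdeg; apply: leq_trans (leqSpred _); rewrite leq_maxl. Qed.

Lemma size_den F : (size (den F) <= (rdeg F).+1)%N.
Proof. by rewrite /rdeg; apply: leq_trans (leqSpred _); rewrite leq_maxr. Qed.

Definition hnum F := hform (rdeg F) (nth 0 (num F)).
Definition hden F := hform (rdeg F) (nth 0 (den F)).

Lemma max_size_gt0 F : (0 < maxn (size (num F)) (size (den F)))%N.
Proof.
rewrite leq_max !lt0n -negb_and; apply/negP => /andP[].
rewrite !size_poly_eq0 => /eqP h1 /eqP h2; have := coprime_nd F.
by rewrite h1 h2 coprimep0 eqp_sym /eqp dvd0p oner_eq0 andbF.
Qed.

(** At infinity one of the two top coefficients is a leading coefficient; at finite points
    coprimality excludes a common zero. *)
Lemma hform_nz F x y : nz x y -> nz (hnum F x y) (hden F x y).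
Proof.
rewrite /hnum /hden; have [->|y0] := eqVneq y 0.
  rewrite {1}/nz eqxx orbF => x0; rewrite !hform_y0 /nz.
  rewrite !mulf_eq0 expf_eq0 (negPf x0) andbF !orbF.
  have m0 := max_size_gt0 F; rewrite /rdeg.
  have [h|h] := leqP (size (den F)) (size (num F)).
    by move: m0; rewrite (maxn_idPl h) size_poly_gt0 -lead_coef_eq0 lead_coefE => ->.
  move: m0; rewrite (maxn_idPr (ltnW h)) size_poly_gt0 -(lead_coef_eq0 (den F)).
  by rewrite lead_coefE => ->; rewrite orbT.
move=> _; rewrite !horner_ratio ?size_num ?size_den // /nz.
rewrite !mulf_eq0 expf_eq0 (negPf y0) andbF /=.
have [h|//] := eqVneq (num F).[x / y] 0.
by rewrite (coprimep_root (coprime_nd F)) // /root h.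
Qed.

Lemma reval_pt F x y : nz x y -> reval F (pt x y) = pt (hnum F x y) (hden F x y).
Proof.
have [->|y0] := eqVneq y 0.
  rewrite {1}/nz eqxx orbF => x0; rewrite pt0 /hnum /hden !hform_y0 /= /pt.
  rewrite mulf_eq0 expf_eq0 (negPf x0) andbF orbF.
  have m0 := max_size_gt0 F; rewrite /rdeg; case: ltngtP => h.
  - by rewrite (nth_default 0 (s := den F)) ?eqxx // -ltnS prednK // (leq_ltn_trans _ h).
  - have d0 : (0 < size (den F))%N by apply: leq_ltn_trans h.
    rewrite -lead_coefE lead_coef_eq0 -size_poly_gt0 d0 nth_default ?mul0r //.
    by rewrite -ltnS prednK.
  - rewrite -h maxnn in m0; rewrite -lead_coefE lead_coef_eq0 -size_poly_gt0 m0.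
    congr Some; rewrite h -lead_coefE -mulf_div divff ?mulr1 //.
    by rewrite expf_eq0 (negPf x0) andbF.
move=> _; rewrite /pt y0 /hnum /hden !horner_ratio ?size_num ?size_den //=.
rewrite mulf_eq0 expf_eq0 (negPf y0) andbF /=; case: eqP => //= h.
by congr Some; rewrite -mulf_div divff ?mul1r // expf_eq0 (negPf y0) andbF.
Qed.

(** The image under [F] of the parametrised curve t -> [A.1(t) : A.2(t)]. *)
Definition curve F (A : {poly C} * {poly C}) : {poly C} * {poly C} :=
  (hform (rdeg F) (cst (nth 0 (num F))) A.1 A.2,
   hform (rdeg F) (cst (nth 0 (den F))) A.1 A.2).

(** A local parametrisation passing through [z] at t = 0, unramified there. *)
Definition chart z : {poly C} * {poly C} :=
  if z is Some x then ('X + x%:P, 1) else (1, 'X).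

Definition ramified (A : {poly C} * {poly C}) := root (wronsk A.1 A.2) 0.

Lemma chart_nz z t : nz (chart z).1.[t] (chart z).2.[t].
Proof. by case: z => [x|] /=; rewrite /nz !hornerE oner_eq0 ?orbT. Qed.

Lemma chart_pt z : pt (chart z).1.[0] (chart z).2.[0] = z.
Proof. by case: z => [x|] /=; rewrite !hornerE /= ?pt1 ?pt0. Qed.

Lemma wronsk_chart z : (wronsk (chart z).1 (chart z).2).[0] != 0.
Proof.
case: z => [x|]; rewrite /wronsk /= -polyC1 !derivE.
  by rewrite addr0 !mulr1 mulr0 subr0 hornerC oner_eq0.
by rewrite mul0r sub0r mulr1 hornerN hornerC oppr_eq0 oner_eq0.
Qed.

Lemma wronsk_comp p q r : wronsk (p \Po r) (q \Po r) = (wronsk p q \Po r) * r^`().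
Proof. by rewrite /wronsk !deriv_comp rmorphB !rmorphM /=; ring. Qed.

Lemma is_critE F z : is_crit F z <-> ramified (curve F (chart z)).
Proof.
case: z => [x|]; rewrite /ramified /=.
  rewrite !hform_shift ?size_num ?size_den // wronsk_comp.
  by rewrite derivD derivX derivC addr0 mulr1 /root horner_comp !hornerE.
by rewrite !hform_homrev ?size_num ?size_den.
Qed.

Lemma curve_horner F A t : (curve F A).1.[t] = hnum F A.1.[t] A.2.[t] /\
  (curve F A).2.[t] = hden F A.1.[t] A.2.[t].
Proof. by rewrite !horner_hform. Qed.

Lemma curve_pt F A t : nz A.1.[t] A.2.[t] ->
  nz (curve F A).1.[t] (curve F A).2.[t] /\
  pt (curve F A).1.[t] (curve F A).2.[t] = reval F (pt A.1.[t] A.2.[t]).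
Proof.
move=> h; have [-> ->] := curve_horner F A t.
by rewrite reval_pt // hform_nz.
Qed.

Lemma root_wronsk_curve f n A t : rdeg f = n.+1 ->
  root (wronsk (curve f A).1 (curve f A).2) t =
  (jac n (nth 0 (num f)) (nth 0 (den f)) A.1.[t] A.2.[t] == 0) || root (wronsk A.1 A.2) t.
Proof.
move=> E; rewrite /root /curve E /=; set W := wronsk (hform _ _ _ _) _.
(* In characteristic 0 the factor n + 1 from Euler's identity does not affect vanishing. *)
have -> : (W.[t] == 0) = ((W *+ n.+1).[t] == 0) by rewrite hornerMn mulrn_eq0.
by rewrite wronsk_hform hornerM horner_jac mulf_eq0.
Qed.

Lemma is_crit_jac f n x y : rdeg f = n.+1 -> nz x y ->
  is_crit f (pt x y) <-> jac n (nth 0 (num f)) (nth 0 (den f)) x y == 0.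
Proof.
move=> E h; rewrite is_critE /ramified (root_wronsk_curve _ _ E).
set z := pt x y; rewrite /(root _ _) (negPf (wronsk_chart _)) orbF.
have e : x * (chart z).2.[0] = (chart z).1.[0] * y.
  by apply/pt_eqP; rewrite ?chart_nz // chart_pt.
(* The Jacobian is homogeneous, so its vanishing is the same at all representatives of a point. *)
have sc (l u v u' v' : C) : l != 0 -> u = l * u' -> v = l * v' ->
    (jac n (nth 0 (num f)) (nth 0 (den f)) u' v' == 0) =
    (jac n (nth 0 (num f)) (nth 0 (den f)) u v == 0).
  by move=> l0 -> ->; rewrite jacZ mulf_eq0 expf_eq0 (negPf l0) andbF.
suff -> : (jac n (nth 0 (num f)) (nth 0 (den f)) (chart z).1.[0] (chart z).2.[0] == 0) =
   (jac n (nth 0 (num f)) (nth 0 (den f)) x y == 0) by [].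
move: e; rewrite /z /pt; case: (eqVneq y 0) h => [->|y0] h /=; rewrite !hornerE => e.
  by apply: (sc x); rewrite ?mulr1 ?mulr0 //; move: h; rewrite /nz eqxx orbF.
by apply: (sc y); rewrite ?mulr1 // mulrCA divff ?mulr1.
Qed.

Lemma curve_ramified f A : (0 < rdeg f)%N -> nz A.1.[0] A.2.[0] ->
  ramified (curve f A) <-> ramified A \/ is_crit f (pt A.1.[0] A.2.[0]).
Proof.
case E: (rdeg f) => [|n] // _ hA.
rewrite (is_crit_jac E hA) /ramified (root_wronsk_curve _ _ E).
by split=> [/orP[]|[]] ->; rewrite ?orbT; auto.
Qed.

Lemma iter_curve_pt f A k t : nz A.1.[t] A.2.[t] ->
  nz (iter k (curve f) A).1.[t] (iter k (curve f) A).2.[t] /\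
  pt (iter k (curve f) A).1.[t] (iter k (curve f) A).2.[t] =
    iter k (reval f) (pt A.1.[t] A.2.[t]).
Proof.
move=> h; elim: k => [|k [IH1 IH2]] //=.
by have [h1 h2] := curve_pt f IH1; split=> //; rewrite -IH2.
Qed.

Lemma iter_curve_ramified f z k : (0 < rdeg f)%N ->
  ramified (iter k (curve f) (chart z)) <->
  exists2 j, (j < k)%N & is_crit f (iter j (reval f) z).
Proof.
move=> d0; elim: k => [|k IH] /=.
  by rewrite /ramified /root (negPf (wronsk_chart _)); split=> // -[].
have [h1 h2] := iter_curve_pt f k (chart_nz z 0).
rewrite curve_ramified // IH h2 chart_pt; split=> [[[j jk hj]|hk]|[j]].
- by exists j => //; apply: ltnW.
- by exists k.
- rewrite ltnS leq_eqVlt => /predU1P[->|jk] hj; [by right|by left; exists j].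
Qed.

(** [F] and the iterate agree only as functions, so their defining polynomials may differ. Their
    image curves still pass through the same points for every t, hence are proportional, and
    [wronsk_germ] compares their ramification. *)
Lemma is_crit_iter F f k z : (0 < rdeg f)%N ->
  (forall z, reval F z = iter k (reval f) z) ->
  is_crit F z <-> exists2 j, (j < k)%N & is_crit f (iter j (reval f) z).
Proof.
move=> d0 hF; rewrite -iter_curve_ramified // is_critE /ramified.
have n1 t := curve_pt F (chart_nz z t).
have n2 t := iter_curve_pt f k (chart_nz z t).
rewrite (@wronsk_germ _ _ _ (iter k (curve f) (chart z)).1 (iter k (curve f) (chart z)).2) //.
- apply: poly_eq_fun => t; rewrite !hornerM; apply/pt_eqP; [exact: (n1 t).1|exact: (n2 t).1|].
  by rewrite (n1 t).2 (n2 t).2.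
- exact: (n1 0).1.
- exact: (n2 0).1.
Qed.

End Crit.

(** * Normal form of bicritical maps *)

Section NormalForm.
Variable C : numClosedFieldType.
Implicit Types (p q A B s : {poly C}) (f : ratmap C).

(** The operator x d/dx is diagonal on monomials, so extreme coefficients of ['X * wronsk p q] are
    easy to read off. *)
Definition euler p := 'X * p^`().

Lemma coef_euler p i : (euler p)`_i = p`_i *+ i.
Proof. by rewrite /euler coefXM coef_deriv; case: i => [|i] //; rewrite mulr0n. Qed.

Lemma mulX_wronsk p q : 'X * wronsk p q = euler p * q - p * euler q.
Proof. by rewrite /wronsk /euler; ring. Qed.

Lemma coefM_top p q m n : (size p <= m.+1)%N -> (size q <= n.+1)%N ->
  (p * q)`_(m + n) = p`_m * q`_n.
Proof.
move=> sp sq; have hm : (m < (m + n).+1)%N by rewrite ltnS leq_addr.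
rewrite coefM (bigD1 (Ordinal hm)) //= addKn big1 ?addr0 // => i hi.
have {}hi : i != m :> nat by [].
have [h|h] := ltnP m i; first by rewrite nth_default ?mul0r // (leq_trans sp).
rewrite [q`_ _]nth_default ?mulr0 // (leq_trans sq) //.
by have := ltn_ord i; lia.
Qed.

(** If A has order j > 0 at 0 and s(0) is nonzero, the lowest term of X W has degree j and
    coefficient j A_j s_0; comparison with c X^(m+1) gives j = m + 1. *)
Lemma wronsk_order A s c m : A`_0 = 0 -> s`_0 != 0 -> c != 0 ->
  wronsk A s = c *: 'X^m -> (forall i, (i <= m)%N -> A`_i = 0) /\ A`_m.+1 != 0.
Proof.
move=> A0 s0 c0 W.
have step j : (forall i, (i < j)%N -> A`_i = 0) -> (A`_j *+ j) * s`_0 = c *+ (j == m.+1).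
  move=> h; have := congr1 (fun p => p`_j) (mulX_wronsk A s).
  rewrite W -scalerAr -exprS coefZ coefXn mulr_natr => ->.
  rewrite coefB !coefM !big_ord_recr /= !big1 ?add0r => [|i _|i _].
  - by rewrite subnn !coef_euler mulr0n mulr0 subr0.
  - by rewrite h ?mul0r.
  - by rewrite coef_euler h ?mul0rn ?mul0r.
have low j : (j <= m)%N -> forall i, (i <= j)%N -> A`_i = 0.
  elim: j => [|j IH] jm i; first by rewrite leqn0 => /eqP ->.
  rewrite leq_eqVlt => /predU1P[->|]; last by rewrite ltnS; apply: IH; apply: ltnW.
  have h : forall i, (i < j.+1)%N -> A`_i = 0 by move=> l; rewrite ltnS; apply: IH; apply: ltnW.
  have := step _ h; rewrite eqSS (ltn_eqF jm) mulr0n => /eqP.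
  by rewrite mulf_eq0 (negPf s0) orbF mulrn_eq0 => /eqP.
have h := low m (leqnn m); split=> //; apply/eqP => h1.
by have := step m.+1 h; rewrite h1 mul0rn mul0r eqxx => /esym/eqP; rewrite (negPf c0).
Qed.

(** The counterpart at infinity: the top coefficient of X W is (deg B - d) lc(B) s_d, nonzero
    because deg B < d. *)
Lemma wronsk_degree B s c m d : (size B <= d)%N -> (size s <= d.+1)%N -> s`_d != 0 ->
  c != 0 -> wronsk B s = c *: 'X^m -> (size B + d = m.+2)%N.
Proof.
move=> sB ss sd c0 W.
have [B0|B0] := eqVneq B 0.
  move: W; rewrite B0 /wronsk derivC mul0r mul0r subrr => /esym/eqP.
  by rewrite scaler_eq0 (negPf c0) -size_poly_eq0 size_polyXn.
have sB0 : (0 < size B)%N by rewrite size_poly_gt0.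
have := congr1 (fun p => p`_((size B).-1 + d)) (mulX_wronsk B s).
have se p : (size (euler p) <= size p)%N.
  by apply/leq_sizeP => j hj; rewrite coef_euler nth_default ?mul0rn.
rewrite W -scalerAr -exprS coefZ coefXn mulr_natr.
rewrite coefB !coefM_top ?prednK ?(leq_trans (se _)) // !coef_euler -lead_coefE.
have -> : lead_coef B *+ (size B).-1 * s`_d - lead_coef B * (s`_d *+ d) =
    - (lead_coef B * s`_d *+ (d - (size B).-1)).
  by rewrite mulrnAl mulrnAr mulrnBr ?opprB //; lia.
case: eqP => [|_ /eqP]; first by lia.
rewrite mulr0n eq_sym oppr_eq0 mulrn_eq0 mulf_eq0 lead_coef_eq0 (negPf B0) (negPf sd) !orbF.
by rewrite subn_eq0; lia.
Qed.

(** In the pencil spanned by p and q, [A] has no constant term and [B] no term of degree d. The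
    order of [A] and the degree of [B] force [A] to be a multiple of X^d and [B] to be constant,
    which kills the middle coefficients of p and q. *)
Lemma wronsk_monomial p q d c m : (0 < d)%N -> (size p <= d.+1)%N -> (size q <= d.+1)%N ->
  nz p`_0 q`_0 -> nz p`_d q`_d -> c != 0 -> wronsk p q = c *: 'X^m ->
  p`_d * q`_0 - p`_0 * q`_d != 0 /\
  forall i, (0 < i < d)%N -> p`_i = 0 /\ q`_i = 0.
Proof.
move=> d0 sp sq n0 nd c0 W.
pose A := q`_0 *: p - p`_0 *: q; pose B := q`_d *: p - p`_d *: q.
have WA (u v : C) : wronsk (v *: p - u *: q) q = v *: wronsk p q /\
   wronsk (v *: p - u *: q) p = u *: wronsk p q.
  by rewrite /wronsk !derivB !derivZ -!mul_polyC; split; ring.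
have A0 : A`_0 = 0 by rewrite coefB !coefZ mulrC subrr.
have [lowA topA] : (forall i, (i <= m)%N -> A`_i = 0) /\ A`_m.+1 != 0.
  case/orP: n0 => h.
    by apply: (@wronsk_order _ p (p`_0 * c)); rewrite ?mulf_neq0 // (WA _ _).2 W scalerA.
  by apply: (@wronsk_order _ q (q`_0 * c)); rewrite ?mulf_neq0 // (WA _ _).1 W scalerA.
have sAB (u v : C) : (size (v *: p - u *: q)%R <= d.+1)%N.
  by rewrite (leq_trans (size_polyD _ _)) // size_polyN geq_max !(leq_trans (size_scale_leq _ _)).
have sB : (size B <= d)%N.
  apply/leq_sizeP => j; rewrite leq_eqVlt => /predU1P[<-|h].
    by rewrite coefB !coefZ mulrC subrr.
  by rewrite nth_default // (leq_trans (sAB _ _)).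
have degB : (size B + d = m.+2)%N.
  case/orP: nd => h.
    by apply: (@wronsk_degree _ p (p`_d * c)); rewrite ?mulf_neq0 // (WA _ _).2 W scalerA.
  by apply: (@wronsk_degree _ q (q`_d * c)); rewrite ?mulf_neq0 // (WA _ _).1 W scalerA.
have md : (m.+1 <= d)%N.
  rewrite -ltnS; apply: leq_trans (sAB (p`_0) (q`_0)).
  by rewrite ltnNge; apply: contra topA => h; rewrite nth_default.
(* The order m + 1 of [A] is at most d, while [B] has size m + 2 - d. *)
have sB1 : (size B <= 1)%N by lia.
have [sB0|sB0] := eqVneq (size B) 0%N.
  have B0 : B = 0 by apply/eqP; rewrite -size_poly_eq0 sB0.
  case/orP: nd => h.
    have := (WA p`_d q`_d).2; rewrite -/B B0 /wronsk derivC !mul0r subrr => /esym/eqP.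
    by rewrite scaler_eq0 (negPf h) /= -/(wronsk p q) W scaler_eq0 (negPf c0) -size_poly_eq0 size_polyXn.
  have := (WA p`_d q`_d).1; rewrite -/B B0 /wronsk derivC !mul0r subrr => /esym/eqP.
  by rewrite scaler_eq0 (negPf h) /= -/(wronsk p q) W scaler_eq0 (negPf c0) -size_poly_eq0 size_polyXn.
have dm : m.+1 = d by lia.
have D0 : p`_d * q`_0 - p`_0 * q`_d != 0.
  by move: topA; rewrite dm coefB !coefZ mulrC.
split=> // i /andP[i0 id].
have a : q`_0 * p`_i = p`_0 * q`_i.
  apply/eqP; rewrite -subr_eq0 -!coefZ -coefB; apply/eqP/lowA.
  by rewrite -ltnS dm.
have b : q`_d * p`_i = p`_d * q`_i.
  apply/eqP; rewrite -subr_eq0 -!coefZ -coefB; apply/eqP/nth_default.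
  exact: leq_trans sB1 i0.
split; apply: (mulfI D0); rewrite mulr0.
- transitivity (p`_d * (q`_0 * p`_i) - p`_0 * (q`_d * p`_i)); first by ring.
  by rewrite a b; ring.
- transitivity (q`_0 * (p`_d * q`_i) - q`_d * (p`_0 * q`_i)); first by ring.
  by rewrite -a -b; ring.
Qed.

Definition powS d (z : sphere C) : sphere C := omap (fun x => x ^+ d) z.

Lemma root0_monomial p : p != 0 -> (forall t, root p t -> t = 0) ->
  exists c m, c != 0 /\ p = c *: 'X^m.
Proof.
move=> p0 h; have [rs e] := closed_field_poly_normal p.
exists (lead_coef p), (size rs); split; first by rewrite lead_coef_eq0.
rewrite {1}e; congr (_ *: _).
have : all (fun r => r == 0) rs.
  apply/allP => r hr; apply/eqP; apply: h; rewrite e rootZ ?lead_coef_eq0 //.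
  by rewrite root_prod_XsubC.
elim: rs {e} => [|r rs IH] /=; first by rewrite big_nil expr0.
by case/andP => /eqP -> /IH; rewrite big_cons subr0 exprS => ->.
Qed.

Lemma size_hform d p A B : (size A <= 2)%N -> (size B <= 2)%N ->
  (size (hform d (cst (nth 0 p)) A B)%R <= d.+1)%N /\
  (hform d (cst (nth 0 p)) A B)`_d = hform d (nth 0 p) A`_1 B`_1.
Proof.
move=> sA sB.
have X (P : {poly C}) n : (size P <= 2)%N -> (size (P ^+ n)%R <= n.+1)%N /\ (P ^+ n)`_n = P`_1 ^+ n.
  move=> sP; elim: n => [|n [I1 I2]]; first by rewrite !expr0 size_poly1 coef1.
  rewrite !exprS -I2 -(@coefM_top P (P ^+ n) 1 n) //; split=> //.
  by have := size_polyMleq P (P ^+ n); lia.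
have T (i : 'I_d.+1) : (size (cst (nth 0 p) i * A ^+ i * B ^+ (d - i))%R <= d.+1)%N /\
   (cst (nth 0 p) i * A ^+ i * B ^+ (d - i))`_d = p`_i * A`_1 ^+ i * B`_1 ^+ (d - i).
  have [a1 a2] := X A i sA; have [b1 b2] := X B (d - i)%N sB.
  have id : (i <= d)%N by rewrite -ltnS.
  rewrite -mulrA mul_polyC; split.
    apply: leq_trans (size_scale_leq _ _) _.
    apply: leq_trans (size_polyMleq _ _) _.
    by rewrite -subn1 leq_subLR (leq_trans (leq_add a1 b1)) // addSn addnS subnKC.
  by rewrite coefZ -mulrA -a2 -b2 -coefM_top // subnKC.
split; first by apply: (leq_trans (size_sum _ _ _)); apply/bigmax_leqP => i _; case: (T i).
by rewrite coef_sum; apply: eq_bigr => i _; case: (T i).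
Qed.

(** Precomposing with a frame at a and b leaves 0 as the only possible finite critical point, so the
    Wronskian is a monomial. By [wronsk_monomial] both components are combinations of z^d and 1;
    their coefficients are the matrix of [M2]. *)
Lemma bicritical_normal_form f a b : (0 < rdeg f)%N -> a <> b ->
  (forall z, is_crit f z <-> (z = a \/ z = b)) ->
  exists M1 M2, [/\ is_mobius M1, is_mobius M2, M1 (Some 0) = a, M1 None = b &
    forall z, reval f (M1 z) = M2 (powS (rdeg f) z)].
Proof.
move=> d0 ab hc; have [p [q [r [s [D ea eb]]]]] := frame_exists ab.
have hM : is_mobius (mobius p q r s) by exists p, q, r, s.
have inj := is_mobius_inj hM.
pose A := (p *: 'X + q%:P, r *: 'X + s%:P).
have sA (u v : C) : (size (u *: 'X + v%:P)%R <= 2)%N.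
  rewrite (leq_trans (size_polyD _ _)) // geq_max (leq_trans (size_scale_leq _ _)) ?size_polyX //=.
  by rewrite (leq_trans (size_polyC_leq1 _)).
have At t : A.1.[t] = p * t + q * 1 /\ A.2.[t] = r * t + s * 1 by rewrite /= !hornerE.
have nzA t : nz A.1.[t] A.2.[t] by have [-> ->] := At t; apply: nz_lin => //; rewrite nz1.
have MA t : mobius p q r s (Some t) = pt A.1.[t] A.2.[t].
  by have [-> ->] := At t; rewrite -pt1 mobius_pt ?nz1.
have nzi : nz p r.
  by have := nz_lin D (nz_inf C); rewrite !mulr1 !mulr0 !addr0.
have Mi : mobius p q r s None = pt p r.
  by rewrite -(pt0 1) mobius_pt ?nz_inf // !mulr1 !mulr0 !addr0.
set d := rdeg f in d0 *.
have [s1 t1] := size_hform d (num f) (sA p q) (sA r s).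
have [s2 t2] := size_hform d (den f) (sA p q) (sA r s).
have cA (u v : C) : (u *: 'X + v%:P)`_1 = u.
  by rewrite coefD coefZ coefX coefC mulr1 addr0.
rewrite !cA in t1 t2.
set P := hform d (cst (nth 0 (num f))) _ _ in s1 t1.
set Q := hform d (cst (nth 0 (den f))) _ _ in s2 t2.
have PQ : curve f A = (P, Q) by [].
have [c [m [c0 W]]] : exists c m, c != 0 /\ wronsk P Q = c *: 'X^m.
  have rt t : root (wronsk P Q) t -> t = 0.
    have [n E] : exists n, rdeg f = n.+1 by exists (rdeg f).-1; rewrite prednK.
    have := root_wronsk_curve A t E; rewrite PQ /= => ->.
    case/orP => [/(is_crit_jac E (nzA t))|].
      by rewrite -MA hc -ea -eb => -[] /inj // [].
    rewrite /wronsk /root !derivD !derivZ derivX !derivC !addr0 !hornerE /= ?mulr1.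
    rewrite [X in X == 0](_ : _ = p * s - q * r); last by ring.
    by rewrite (negPf D).
  apply: root0_monomial => //; apply/eqP => W0.
  have : root (wronsk P Q) 1 by rewrite W0 root0.
  by move/rt/eqP; rewrite oner_eq0.
have n0 : nz P`_0 Q`_0 by rewrite -!horner_coef0; apply: (curve_pt f (nzA 0)).1.
have nd : nz P`_d Q`_d by rewrite t1 t2; apply: hform_nz.
have [DD mid] := wronsk_monomial d0 s1 s2 n0 nd c0 W.
exists (mobius p q r s), (mobius P`_d P`_0 Q`_d Q`_0); split=> //.
  by exists P`_d, P`_0, Q`_d, Q`_0.
have hor (S : {poly C}) t : (size S <= d.+1)%N -> (forall i, (0 < i < d)%N -> S`_i = 0) ->
    S.[t] = S`_d * t ^+ d + S`_0 * 1.
  move=> sS hS; rewrite (horner_coef_wide _ sS).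
  case: (d) d0 hS => // n _ hS; rewrite big_ord_recr big_ord_recl /= expr0 big1 ?addr0.
    by rewrite addrC.
  by move=> i _; rewrite hS ?mul0r //= /bump leq0n add1n ltnS ltn_ord.
case=> [t|].
  have -> : powS d (Some t) = pt (t ^+ d) 1 by rewrite pt1.
  rewrite MA -(curve_pt f (nzA t)).2 PQ mobius_pt ?nz1 //=.
  by rewrite !hor // => i /mid[].
have -> : powS d None = pt 1 0 :> sphere C by rewrite pt0.
rewrite Mi reval_pt // /hnum /hden -/d -t1 -t2 mobius_pt ?nz_inf //.
by rewrite !mulr1 !mulr0 !addr0.
Qed.

End NormalForm.

(** * Orbit counting *)

Local Close Scope ring_scope.

(** Used with [o] an orbit size and [n] the group order: n / o is then the order of a nontrivial
    stabiliser. *)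
Lemma divisor_cases n d o :
  (forall p, prime p -> p %| n -> p %| d) -> o %| n -> o < n ->
  [\/ (o * 2 = n /\ 2 %| d), (o * 3 = n /\ 3 %| d) | o * 4 <= n].
Proof.
move=> hp /dvdnP[r e] lt; rewrite e in lt.
case: r => [|[|[|[|r]]]] in e lt *; try lia.
- by constructor 1; split; [lia|apply: hp => //; rewrite e dvdn_mulr].
- by constructor 2; split; [lia|apply: hp => //; rewrite e dvdn_mulr].
- by constructor 3; rewrite e mulnC leq_mul2r orbT.
Qed.

(** Stabiliser orders (2, 2) give the conclusion directly. Orders (2, 3) force 6 to divide d, and
    (2, at least 4) forces d >= 4; in every case except (2, 2) the sum m + o1 + o2 is then at most
    n, a contradiction. *)
Lemma three_orbits_arith n d m o1 o2 r : 3 <= d -> m * d <= n -> n + 2 + r = m + o1 + o2 ->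
  [\/ (o1 * 2 = n /\ 2 %| d), (o1 * 3 = n /\ 3 %| d) | o1 * 4 <= n] ->
  [\/ (o2 * 2 = n /\ 2 %| d), (o2 * 3 = n /\ 3 %| d) | o2 * 4 <= n] ->
  r + 2 = m.
Proof.
move=> d3 md e h1 h2.
have mono k : k <= d -> m * k <= n by move=> h; apply: leq_trans md; rewrite leq_mul2l h orbT.
have d4 : 2 %| d -> m * 4 <= n.
  by move=> h; apply: mono; case: (ltngtP d 3) d3 h => // ->.
have d6 : 2 %| d -> 3 %| d -> m * 6 <= n.
  move=> h h'; apply/mono/dvdn_leq; first exact: leq_trans d3.
  by rewrite (@Gauss_dvd 2 3) ?h.
have {mono md} m3 := mono 3 d3.
case: h1 => [[e1 t1]|[e1 t1]|e1]; case: h2 => [[e2 t2]|[e2 t2]|e2].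
- by clear -e e1 e2; lia.
- by have := d6 t1 t2; clear -e e1 e2; lia.
- by have := d4 t1; clear -e e1 e2; lia.
- by have := d6 t2 t1; clear -e e1 e2; lia.
- by clear -e e1 e2 m3; lia.
- by clear -e e1 e2 m3; lia.
- by have := d4 t2; clear -e e1 e2; lia.
- by clear -e e1 e2 m3; lia.
- by clear -e e1 e2 m3; lia.
Qed.

Lemma sum_pos_witness (I : finType) (P : pred I) (w : I -> nat) :
  0 < \sum_(O | P O) w O -> exists2 O, P O & 0 < w O.
Proof.
rewrite lt0n sum_nat_eq0 negb_forall => /existsP[O]; rewrite negb_imply => /andP[h1 h2].
by exists O; rewrite // lt0n.
Qed.

(* The Riemann-Hurwitz type count behind the classification of finite rotation groups,
   for orbits of sizes [sz]: the tetrahedral, octahedral and icosahedral signatures are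
   excluded because every prime dividing the order [n] of the group divides [d]. *)
Lemma orbit_sizes_dichotomy (I : finType) (P : pred I) (sz : I -> nat) n d a b :
  3 <= d -> 0 < n -> (forall p, prime p -> p %| n -> p %| d) ->
  (forall O, P O -> 0 < sz O /\ sz O %| n) ->
  P a -> P b -> sz a * d <= n -> sz b * d <= n ->
  \sum_(O | P O) (n - sz O) = (n.-1).*2 ->
  if a == b then sz a <= 2 else sz a <= 1.
Proof.
move=> d3 n0 hp hO Pa Pb ha hb.
have caseO O : P O -> 0 < n - sz O ->
  [\/ (sz O * 2 = n /\ 2 %| d), (sz O * 3 = n /\ 3 %| d) | sz O * 4 <= n].
  by move=> /hO[_ h1] h2; apply: (divisor_cases hp h1); rewrite -subn_gt0.
have mono k o : k <= d -> o * d <= n -> o * k <= n.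
  by move=> h h2; apply: leq_trans h2; rewrite leq_mul2l h orbT.
have d4 : 2 %| d -> 4 <= d by move=> h; case: (ltngtP d 3) d3 h => // ->.
have orb_le O : P O -> 0 < n - sz O -> sz O * 2 <= n.
  by move=> h1 h2; case: (caseO O h1 h2) => [[e _]|[e _]|e]; clear -e; lia.
have a3 := mono 3 _ d3 ha; have b3 := mono 3 _ d3 hb.
rewrite (bigD1 a) //=; have [_|nab] := eqVneq a b.
  rewrite leqNgt; set R := (\sum_(_ | _) _) => E; apply/negP => gt2.
  have /sum_pos_witness[O1 h1 /= w1] : 0 < R by clear -E gt2 a3; lia.
  move: E; rewrite /R (bigD1 O1) //=; set R1 := (\sum_(_ | _) _) => E.
  case/andP: h1 => h1 _.
  have [o1 _] := hO _ h1.
  have /sum_pos_witness[O2 h2 /= w2] : 0 < R1 by clear -E gt2 a3 o1 w1 n0; lia.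
  move: E; rewrite /R1 (bigD1 O2) //=; set R2 := (\sum_(_ | _) _) => E.
  case/andP: h2 => /andP[h2 _] _.
  have e2 : n + 2 + R2 = sz a + sz O1 + sz O2 by clear -E a3 w1 w2 n0; lia.
  have e3 := three_orbits_arith d3 ha e2 (caseO _ h1 w1) (caseO _ h2 w2).
  (* The remaining defect is [sz a - 2 > 0], so there is a further nonfree orbit; its defect is at
     least n / 2, but [sz a] is at most n / 3. *)
  have /sum_pos_witness[O3 h3 /= w3] : 0 < R2 by clear -e3 gt2; lia.
  have le3 : n - sz O3 <= R2 by rewrite /R2 (bigD1 O3) //= leq_addr.
  case/andP: h3 => /andP[/andP[h3 _] _] _.
  have o3 := orb_le _ h3 w3.
  by clear -e3 a3 le3 o3 w3; lia.
have Pb' : P b && (b != a) by rewrite Pb eq_sym.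
rewrite (bigD1 b) //=; set R := (\sum_(_ | _) _) => E.
have e : R + 2 = sz a + sz b by clear -E a3 b3 n0; lia.
have [R0|Rpos] := posnP R.
  by have [h _] := hO _ Pb; clear -e R0 h; lia.
(* A further orbit has defect n / 2 (and then d >= 4), 2n / 3, or at least 3n / 4; each exceeds
   [sz a + sz b - 2]. *)
exfalso; have /sum_pos_witness[O1 h1 /= w1] := Rpos.
have le1 : n - sz O1 <= R by rewrite /R (bigD1 O1) //= leq_addr.
case/andP: h1 => /andP[h1 _] _.
case: (caseO _ h1 w1) => [[e1 t1]|[e1 t1]|e1].
- have a4 := mono 4 _ (d4 t1) ha; have b4 := mono 4 _ (d4 t1) hb.
  by clear -e le1 e1 a4 b4 n0; lia.
- by clear -e le1 e1 a3 b3 n0; lia.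
- by clear -e le1 e1 a3 b3 n0; lia.
Qed.

(** * Orbit counting for permutation groups whose nontrivial elements fix two points *)

Section Count.
Variables (T : finType) (G : {group {perm T}}).
Local Notation N := #|G|.
Local Notation Orb := (orbit 'P G @: [set: T]).

(** By Cauchy-Frobenius, N times the number of orbits is |T| + 2(N - 1); the orbit sizes add up to
    |T|. *)
Lemma sum_orbit_defect :
  (forall s, s \in G -> s != 1%g -> #|afix 'P [set s]| = 2) ->
  \sum_(O in Orb) (N - #|O|) = (N.-1).*2.
Proof.
move=> fix2; have aT : [acts G, on [set: T] | 'P] by apply/actsP => s _ x; rewrite !inE.
have hO O : O \in Orb -> #|O| <= N.
  by case/imsetP => x _ ->; apply: dvdn_leq (dvdn_orbit _ _ _); apply: cardG_gt0.
apply: (@addIn #|T|); rewrite -[in LHS]cardsT -(acts_sum_card_orbit aT) -big_split /=.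
rewrite (eq_bigr (fun=> N)) => [|O /hO h]; last by rewrite subnK.
rewrite sum_nat_const -(Frobenius_Cauchy aT) (bigD1 1%g) //=.
rewrite (eq_bigr (fun=> 2)) => [|s /andP[sG s1]]; last by rewrite setTI fix2.
rewrite sum_nat_const setTI afix1 cardsT addnC -muln2 (cardD1 1%g G) group1.
have -> : (true + #|[predD1 G & 1%g]|).-1 = #|[predD1 G & 1%g]| by [].
by congr (_ * _ + _); apply: eq_card => s; rewrite !inE andbC.
Qed.

Lemma card_orbit_le d x : d <= #|'C_G[x | 'P]%g| -> #|orbit 'P G x| * d <= N.
Proof. by move=> h; rewrite -(card_orbit_stab 'P G x) leq_mul2l h orbT. Qed.

Lemma axis_invariant (a b : T) d :
  a != b -> 3 <= d -> (forall p, prime p -> p %| N -> p %| d) ->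
  (forall s, s \in G -> s != 1%g -> #|afix 'P [set s]| = 2) ->
  d <= #|'C_G[a | 'P]%g| -> d <= #|'C_G[b | 'P]%g| ->
  forall s, s \in G -> s a = a \/ s a = b.
Proof.
move=> ab d3 hp fix2 da db s sG.
have sa : s a \in orbit 'P G a by apply/orbitP; exists s.
have hO O : O \in Orb -> 0 < #|O| /\ #|O| %| N.
  case/imsetP => x _ ->; split; last exact: dvdn_orbit.
  by rewrite card_gt0; apply/set0Pn; exists x; apply: orbit_refl.
have Oa : orbit 'P G a \in Orb by apply: imset_f.
have Ob : orbit 'P G b \in Orb by apply: imset_f.
have := orbit_sizes_dichotomy d3 (cardG_gt0 G) hp hO Oa Ob
  (card_orbit_le da) (card_orbit_le db) (sum_orbit_defect fix2).
(* Either [a] and [b] share an orbit, of size at most 2 and so equal to {a, b}, or the orbit of [a]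
   is a single point. *)
have [eab|_] := eqVneq => le; last first.
  by left; apply: (card_le1_eqP le) => //; apply: orbit_refl.
have sub : [set a; b] \subset orbit 'P G a.
  by apply/subsetP => x; rewrite !inE => /orP[] /eqP ->; last rewrite eab; exact: orbit_refl.
move: sa; have /eqP <- : [set a; b] == orbit 'P G a by rewrite eqEcard sub cards2 ab.
by rewrite !inE => /orP[] /eqP; auto.
Qed.

End Count.

(** * Fibres and deck transformations of iterates *)

Local Open Scope ring_scope.

Section Sphere.
Variable C : numClosedFieldType.

Lemma roots_of_unity d : (0 < d)%N -> exists rs : seq C,
  [/\ uniq rs, size rs = d & forall x, (x \in rs) = (x ^+ d == 1)].
Proof.
move=> d0; have [rs] := closed_field_poly_normal ('X^d - 1 : {poly C}).
rewrite (monicP (monicXnsubC _ d0)) scale1r => e.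
exists rs; split=> [||x].
- by rewrite -separable_prod_XsubC -e separable_Xn_sub_1 // pnatr_eq0 -lt0n.
- by apply/eqP; rewrite -eqSS -(size_prod_XsubC rs id) -e size_XnsubC.
- by rewrite -root_prod_XsubC -e /root !hornerE subr_eq0.
Qed.

Lemma powS_fiber d (x : sphere C) : (0 < d)%N -> exists l : seq (sphere C),
  [/\ uniq l, forall y, (y \in l) = (powS d y == x) &
      x <> Some 0 -> x <> None -> size l = d].
Proof.
move=> d0; case: x => [c|]; last by exists [:: None]; split=> // -[y|].
have [->|c0] := eqVneq c 0.
  exists [:: Some 0]; split=> // -[y|] //; rewrite inE /powS /=.
  by rewrite !(inj_eq Some_inj) expf_eq0 d0.
have [rs [u s m]] := roots_of_unity d0.
pose r := d.-root c; have rd : r ^+ d = c by rewrite rootCK.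
have r0 : r != 0 by rewrite rootC_eq0.
exists [seq Some (r * w) | w <- rs]; split=> [|y|_ _].
- by rewrite map_inj_uniq // => v w [] /(mulfI r0).
- case: y => [y|]; last by apply/mapP => -[].
  rewrite /powS /= (inj_eq Some_inj); apply/mapP/eqP => [[w]|h].
    by rewrite m => /eqP hw [->]; rewrite exprMn rd hw mulr1.
  exists (y / r); last by rewrite mulrCA divff ?mulr1.
  by rewrite m expr_div_n h rd divff.
- by rewrite size_map.
Qed.

Lemma sphere_avoid (l : seq (sphere C)) : exists x, x \notin l.
Proof.
apply: contrapT => h.
pose s : seq (sphere C) := [seq Some (i%:R) | i <- iota 0 (size l).+1].
have us : uniq s.
  by rewrite map_inj_uniq ?iota_uniq // => i j [] /eqP; rewrite eqr_nat => /eqP.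
have := uniq_leq_size us; rewrite size_map size_iota => /(_ l).
rewrite ltnn => H; suff: false by []; apply: H => x _.
by apply: contrapT => /negP hx; apply: h; exists x.
Qed.

Lemma finite_union (A : eqType) (s : seq A) (P : A -> sphere C -> Prop) :
  (forall x, x \in s -> exists l : seq (sphere C), forall z, P x z -> z \in l) ->
  exists l : seq (sphere C), forall x z, x \in s -> P x z -> z \in l.
Proof.
elim: s => [|x s IH] h; first by exists [::].
have [l1 h1] := h x (mem_head _ _).
have [l2 h2] : exists l : seq (sphere C), forall x z, x \in s -> P x z -> z \in l.
  by apply: IH => y ys; apply: h; rewrite inE ys orbT.
exists (l1 ++ l2) => y z; rewrite mem_cat inE => /predU1P[->|ys] hz.
  by rewrite h1.
by rewrite (h2 y) ?orbT.
Qed.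

Lemma fixpoints_finite (s : sphere C -> sphere C) : is_mobius s -> (exists z, s z <> z) ->
  exists l : seq (sphere C), forall x, s x = x -> x \in l.
Proof.
move=> hs [z0 hz]; have [[x hx]|h0] := pselect (exists x, s x = x); last first.
  by exists [::] => x hx; case: h0; exists x.
have [[y [hy yx]]|h1] := pselect (exists y, s y = y /\ y <> x); last first.
  exists [:: x] => y hy; rewrite inE; apply/eqP; apply: contrapT => yx.
  by apply: h1; exists y.
exists [:: x; y] => z hz'; apply: contrapT => /negP; rewrite !inE negb_or => /andP[/eqP zx /eqP zy].
by apply: hz; apply: (@mobius_fix3 _ s z x y) => //; apply/nesym.
Qed.

End Sphere.

(** * Fibres of iterates of a map conjugate on both sides to a power map *)

Section Unicritical.
Variable C : numClosedFieldType.
Variables (g M1 M2 : sphere C -> sphere C) (d : nat).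
Hypothesis d3 : (3 <= d)%N.
Hypothesis hM1 : is_mobius M1.
Hypothesis hM2 : is_mobius M2.
Hypothesis hg : forall z, g (M1 z) = M2 (powS d z).

Local Notation a := (M1 (Some 0)).
Local Notation b := (M1 None).
Local Notation v1 := (M2 (Some 0)).
Local Notation v2 := (M2 None).

Let d0 : (0 < d)%N. Proof. exact: leq_trans d3. Qed.
Let inj1 := is_mobius_inj hM1.
Let inj2 := is_mobius_inj hM2.

Lemma critpoints_neq : a <> b. Proof. by move/inj1. Qed.

Lemma g_a : g a = v1. Proof. by rewrite hg /powS /= expr0n; case: d d0. Qed.
Lemma g_b : g b = v2. Proof. by rewrite hg. Qed.

Lemma g_fiber x : exists l : seq (sphere C),
  [/\ uniq l, forall y, (y \in l) = (g y == x) & x <> v1 -> x <> v2 -> size l = d].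
Proof.
have [m1 [_ k1 k1']] := is_mobius_inv hM1; have [m2 [_ k2 k2']] := is_mobius_inv hM2.
have [l [u m s]] := powS_fiber (m2 x) d0.
exists (map M1 l); split=> [|y|n1 n2]; first by rewrite map_inj_uniq.
  rewrite -{1}(k1' y) mem_map // m -{2}(k1' y) hg; apply/eqP/eqP => [->|<-] //.
by rewrite size_map s // => h; [apply: n1|apply: n2]; rewrite -h k2'.
Qed.

Lemma g_fiber_v1 y : g y = v1 -> y = a.
Proof.
have [m1 [_ k1 k1']] := is_mobius_inv hM1.
rewrite -(k1' y) hg => /inj2; case: (m1 y) => // x [] /eqP.
by rewrite expf_eq0 d0 => /eqP ->.
Qed.

Lemma g_fiber_v2 y : g y = v2 -> y = b.
Proof.
have [m1 [_ k1 k1']] := is_mobius_inv hM1.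
by rewrite -(k1' y) hg => /inj2; case: (m1 y).
Qed.

(** The excluded values are the critical values of the k-th iterate. Away from them no intermediate
    preimage equals v1 or v2, so each step multiplies the fibre size by d. *)
Lemma iter_fiber k x : exists l : seq (sphere C),
  [/\ uniq l, forall y, (y \in l) = (iter k g y == x) &
    (forall j, (j < k)%N -> x <> iter j g v1 /\ x <> iter j g v2) -> size l = (d ^ k)%N].
Proof.
elim: k => [|k [l [u m s]]]; first by exists [:: x]; split=> // y; rewrite inE.
have {}s : (forall j, (j < k.+1)%N -> x <> iter j g v1 /\ x <> iter j g v2) -> size l = (d ^ k)%N.
  by move=> h; apply: s => j jk; apply: h; apply: ltnW.
have main (s0 : seq (sphere C)) : uniq s0 -> exists l',
    [/\ uniq l', forall y, (y \in l') = (g y \in s0) &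
      (forall z, z \in s0 -> z <> v1 /\ z <> v2) -> size l' = (d * size s0)%N].
  elim: s0 => [|z s0 IH] /=; first by exists [::]; split=> //; rewrite muln0.
  case/andP => zs /IH[l1 [u1 m1 e1]]; have [l2 [u2 m2 e2]] := g_fiber z.
  exists (l2 ++ l1); split=> [|y|h].
  - rewrite cat_uniq u1 u2 andbT; apply/hasPn => y; rewrite m1 m2 => h.
    by apply: contra zs => /eqP <-.
  - by rewrite mem_cat m1 m2 inE.
  - have [n1 n2] := h z (mem_head _ _).
    rewrite size_cat e2 // e1 ?mulnS // => t ts; apply: h.
    by rewrite inE ts orbT.
have [l' [u' m' s']] := main l u.
exists l'; split=> // [y|h]; first by rewrite m' m iterSr.
rewrite s' ?s // ?expnS // => z; rewrite m => /eqP e; have [n1 n2] := h k (leqnn _).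
by split=> ez; [apply: n1|apply: n2]; rewrite -ez e.
Qed.

Lemma iter_saturation k (W : seq (sphere C)) : exists Y : seq (sphere C),
  forall y, (y \in Y) = (iter k g y \in W).
Proof.
elim: W => [|w W [Y h]]; first by exists [::].
have [l [_ m _]] := iter_fiber k w.
by exists (l ++ Y) => y; rewrite mem_cat m h inE.
Qed.

(** Over v1 or v2 the last point of the orbit before x must be a or b. Over any other x a backward
    orbit avoiding a and b is constructed. *)
Lemma critical_values_of_iterate k x : (0 < k)%N ->
  (x = v1 \/ x = v2) <->
  (forall y, iter k g y = x -> exists2 j, (j < k)%N & iter j g y = a \/ iter j g y = b).
Proof.
case: k => // k _; split=> [h y|h].
  rewrite iterS => e; exists k => //.
  case: h => h; rewrite h in e; [left; exact: g_fiber_v1|right; exact: g_fiber_v2].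
apply: contrapT => nx.
suff [y [ey ny]] : exists y, iter k.+1 g y = x /\
    forall j, (j < k.+1)%N -> ~ (iter j g y = a \/ iter j g y = b).
  by have [j jk /(ny j jk)] := h y ey.
(* The start of the backward orbit is also kept away from v1 and v2: its fibre then has d >= 3
   points, so one of them again avoids both values. *)
suff [y [_ ey ny]] : exists y, [/\ ~ (y = v1 \/ y = v2), iter k.+1 g y = x &
    forall j, (j < k.+1)%N -> ~ (iter j g y = a \/ iter j g y = b)] by exists y.
elim: k.+1 => {k h} [|k [z [nz ez ncz]]]; first by exists x.
have [l [u m s]] := g_fiber z.
have [y yl yv] : exists2 y, y \in l & y \notin [:: v1; v2].
  apply/hasP; rewrite has_predC; apply/negP => /allP sub.
  have := uniq_leq_size u sub; rewrite s => [|h|h]; last 2 first.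
  - by apply: nz; left.
  - by apply: nz; right.
  by rewrite leqNgt d3.
move: yl; rewrite m => /eqP gy.
exists y; split.
- by move: yv; rewrite !inE => /norP[/eqP h1 /eqP h2] [].
- by rewrite iterSr gy.
case=> [_|j jk]; last by rewrite iterSr gy; apply: ncz.
by case=> /= h; apply: nz; rewrite -gy h ?g_a ?g_b; auto.
Qed.

Lemma rotation_exists (w : C) : w ^+ d = 1 -> exists t,
  [/\ is_mobius t, forall z, g (t z) = g z, t a = a, t b = b &
    forall x, t (M1 (Some x)) = M1 (Some (w * x))].
Proof.
move=> hw; have [m1 [hm1 k1 k1']] := is_mobius_inv hM1.
have w0 : w != 0 by apply/eqP => h; move/eqP: hw; rewrite h expr0n (gtn_eqF d0) eq_sym oner_eq0.
pose t0 := mobius w 0 0 1.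
have t0S x : t0 (Some x) = Some (w * x).
  by rewrite /t0 /= mul0r add0r oner_eq0 addr0 divr1.
have t0I : t0 None = None by rewrite /t0 /= eqxx.
have ht0 : is_mobius t0 by exists w, 0, 0, 1; rewrite mulr1 mul0r subr0.
exists (fun z => M1 (t0 (m1 z))); split.
- by apply: is_mobius_comp => //; apply: is_mobius_comp.
- move=> z; rewrite -{2}(k1' z) !hg; congr M2; case: (m1 z) => [x|]; last by rewrite t0I.
  by rewrite t0S /powS /= exprMn hw mul1r.
- by rewrite k1 t0S mulr0.
- by rewrite k1 t0I.
- by move=> x; rewrite k1 t0S.
Qed.

Definition deck k (t : sphere C -> sphere C) :=
  is_mobius t /\ forall z, iter k g (t z) = iter k g z.

Lemma rotation_deck k t : (0 < k)%N -> is_mobius t -> (forall z, g (t z) = g z) -> deck k t.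
Proof. by case: k => // k _ ht h; split=> // z; rewrite !iterSr h. Qed.

Lemma deck_order_ge3 k : (0 < k)%N -> exists t, deck k t /\ order_ge3 t.
Proof.
move=> k0; have [rs [u s m]] := roots_of_unity C d0.
(* Three or more roots of unity cannot all be 1 or -1; a root with w^2 different from 1 gives a
   rotation that is not an involution. *)
have [w wl wn] : exists2 w, w \in rs & w \notin [:: 1; -1].
  apply/hasP; rewrite has_predC; apply/negP => /allP sub.
  by have := uniq_leq_size u sub; rewrite s leqNgt d3.
move: wl; rewrite m => /eqP hw.
have [t [ht gt ta tb t1]] := rotation_exists hw.
exists t; split; first exact: rotation_deck.
move: wn; rewrite !inE -sqrf_eq1 => /negP w2.
split; exists (M1 (Some 1)) => h; apply: w2; move: h; rewrite !t1 => /inj1[] /eqP.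
  by rewrite mulr1 => /eqP ->; rewrite expr1n.
by rewrite mulr1 -expr2.
Qed.

(** * The deck group of an iterate and its invariant axis *)

Section Deck.
Variable k : nat.
Hypothesis k0 : (0 < k)%N.

Local Notation gk := (iter k g).

Lemma generic_fiber (X : seq (sphere C)) : exists w (l : seq (sphere C)),
  [/\ w \notin X, uniq l, forall y, (y \in l) = (gk y == w) & size l = (d ^ k)%N].
Proof.
(* The critical values of the k-th iterate. *)
pose V := [seq iter j g v1 | j <- iota 0 k] ++ [seq iter j g v2 | j <- iota 0 k].
have [w] := sphere_avoid (X ++ V); rewrite !mem_cat !negb_or => /andP[wX /andP[w1 w2]].
have [l [u m s]] := iter_fiber k w; exists w, l; split=> //; apply: s => j jk.
have ji : j \in iota 0 k by rewrite mem_iota.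
by split=> e; [move/negP: w1|move/negP: w2]; apply; rewrite e; apply/mapP; exists j.
Qed.

Lemma dk3 : (3 <= d ^ k)%N.
Proof. by apply: leq_trans d3 _; rewrite -{1}(expn1 d) leq_exp2l // (leq_trans _ d3). Qed.

Lemma uniq3 (l : seq (sphere C)) : uniq l -> (3 <= size l)%N -> exists x y z,
  [/\ [/\ x \in l, y \in l & z \in l], x <> y, x <> z & y <> z].
Proof.
case: l => [|x [|y [|z l]]] //= /andP[h1 /andP[h2 _]] _.
move: h1 h2; rewrite !inE !negb_or => /andP[/eqP xy /andP[/eqP xz _]] /andP[/eqP yz _].
by exists x, y, z; rewrite !inE !eqxx !orbT.
Qed.

(** A deck transformation preserves a generic fibre and is determined by its images of three points
    there, so there are finitely many; each nontrivial one has finitely many fixed points. *)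
Lemma deck_fixpoints_finite : exists X : seq (sphere C),
  forall t x, deck k t -> (exists z, t z <> z) -> t x = x -> x \in X.
Proof.
have [w [l [_ u m s]]] := generic_fiber [::].
have [x [y [z [[xl yl zl] xy xz yz]]]] : exists x y z,
  [/\ [/\ x \in l, y \in l & z \in l], x <> y, x <> z & y <> z].
  by apply: uniq3; rewrite // s dk3.
pose P (p : sphere C * sphere C * sphere C) q := exists t, [/\ deck k t, exists z, t z <> z,
  [/\ t x = p.1.1, t y = p.1.2 & t z = p.2] & t q = q].
have [|X hX] := @finite_union C _ [seq (p, q) | p <- [seq (p1, p2) | p1 <- l, p2 <- l], q <- l] P.
  move=> p _; have [[t [[ht _] nt [ex ey ez]]]|h] :=
    pselect (exists t, [/\ deck k t, exists z, t z <> z & [/\ t x = p.1.1, t y = p.1.2 & t z = p.2]]).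
    have [X hX] := fixpoints_finite ht nt; exists X => q [t' [[ht' _] _ [ex' ey' ez'] fq]].
    apply: hX; rewrite -[RHS]fq.
    by apply: (mobius_eq3 ht ht' xy xz yz); rewrite ?ex ?ey ?ez.
  by exists [::] => q [t [h1 h2 h3 _]]; case: h; exists t.
exists X => t q ht nt fq; apply: (hX (t x, t y, t z)); last by exists t.
have tl p : p \in l -> t p \in l by rewrite !m ht.2.
by apply: allpairs_f; rewrite ?tl //; apply: allpairs_f; rewrite tl.
Qed.

(** * Deck transformations as permutations of a finite union of fibres *)

Section Perm.
Variable Y : seq (option C).
Hypothesis Ysat : forall y y', gk y = gk y' -> (y \in Y) = (y' \in Y).
Local Notation YT := (seq_sub Y).

Definition induced (t : sphere C -> sphere C) (s : {perm YT}) :=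
  forall y, ssval (s y) = t (ssval y).

Lemma deck_perm t : deck k t -> exists s, induced t s.
Proof.
move=> [ht e]; have hY (y : YT) : t (ssval y) \in Y by rewrite (Ysat (e _)); apply: ssvalP.
have ij : injective (fun y : YT => SeqSub (hY y)).
  by move=> y y' /(congr1 val) /= /(is_mobius_inj ht) /val_inj.
by exists (perm ij) => y; rewrite permE.
Qed.

Definition deck_perms : {set {perm YT}} := [set s | `[< exists t, deck k t /\ induced t s >]].

Lemma deck_permsP s : reflect (exists t, deck k t /\ induced t s) (s \in deck_perms).
Proof. by rewrite inE; apply: asboolP. Qed.

Lemma group_set_deck_perms : group_set deck_perms.
Proof.
apply/group_setP; split.
  apply/deck_permsP; exists (fun z => z); split; last by move=> y; rewrite perm1.
  by split=> //; apply: is_mobius_id.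
move=> s s' /deck_permsP[t [[ht e] h]] /deck_permsP[t' [[ht' e'] h']].
apply/deck_permsP; exists (fun z => t' (t z)); split; last by move=> y; rewrite permM h' h.
by split; [apply: is_mobius_comp|move=> z; rewrite e' e].
Qed.

Canonical deck_group := Group group_set_deck_perms.

Lemma induced_expg t s n : induced t s -> induced (iter n t) (s ^+ n)%g.
Proof.
by move=> h; elim: n => [|n IH] y; rewrite ?expg0 ?perm1 // expgSr permM h IH.
Qed.

End Perm.

(** The deck group acts faithfully on a suitable finite set [Y], which turns the claim into
    [axis_invariant]. *)
Lemma deck_axis t : deck k t -> (t a = a \/ t a = b) /\ (t b = b \/ t b = a).
Proof.
move=> ht; have [X hX] := deck_fixpoints_finite.
have [w [l [wX u m s]]] := generic_fiber (map gk X).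
(* [Y] must contain a and b, every fixed point of a nontrivial deck transformation, and a fibre over
   [w] free of such fixed points. *)
have [Y0 hY0] := iter_saturation k [:: w, gk a, gk b & map gk X].
pose Y : seq (option C) := Y0.
have hY y : (y \in Y) = (gk y \in [:: w, gk a, gk b & map gk X]) by apply: hY0.
have Ysat y y' : gk y = gk y' -> (y \in Y) = (y' \in Y) by move=> e; rewrite !hY e.
have aY : a \in Y by rewrite hY !inE eqxx orbT.
have bY : b \in Y by rewrite hY !inE eqxx !orbT.
have lY y : y \in l -> y \in Y by rewrite m hY => /eqP ->; rewrite mem_head.
have XY x : x \in X -> x \in Y by move=> xX; rewrite hY !inE map_f ?orbT.
have [p [q [r [[pl ql rl] pq pr qr]]]] : exists x y z,
  [/\ [/\ x \in l, y \in l & z \in l], x <> y, x <> z & y <> z].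
  by apply: uniq3; rewrite // s dk3.
pose G := deck_group Y.
(* [Y] contains three distinct points, so Moebius maps are determined by their restriction to it. *)
have eqY t1 t2 : is_mobius t1 -> is_mobius t2 -> (forall y, y \in Y -> t1 y = t2 y) -> t1 =1 t2.
  by move=> h1 h2 e; apply: (mobius_eq3 h1 h2 pq pr qr); apply/e/lY.
have nontriv (sg : {perm seq_sub Y}) tg : induced tg sg -> sg != 1%g -> exists z, tg z <> z.
  move=> h s1; apply: contrapT => h1; move/eqP: s1; apply; apply/permP => y; apply: val_inj.
  rewrite perm1 /= h; apply: contrapT => h2; apply: h1; by exists (ssval y).
have fix2 sg : sg \in G -> sg != 1%g -> #|afix 'P [set sg]| = 2.
  move=> /deck_permsP[tg [dg h]] s1; have nt := nontriv _ _ h s1.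
  have [|x [y [xy fx fy]]] := @mobius_torsion_fix2 C tg (#[sg]%g).-1 dg.1 _ nt.
    rewrite prednK ?order_gt0 //; apply: (eqY _ (fun z => z)).
    - exact: is_mobius_iter dg.1.
    - exact: is_mobius_id.
    by move=> y yY; have := induced_expg #[sg]%g h (SeqSub yY); rewrite expg_order perm1 /=.
  have xY : x \in Y by apply/XY/(hX tg).
  have yY : y \in Y by apply/XY/(hX tg).
  suff -> : afix 'P [set sg] = [set SeqSub xY; SeqSub yY].
    by rewrite cards2; case: eqP => // -[/xy].
  apply/setP => z; rewrite !inE sub1set inE /= /aperm; apply/eqP/orP => [hz|].
    have fz : tg (ssval z) = ssval z by rewrite -h hz.
    rewrite -!(inj_eq val_inj) /=; apply: contrapT => /not_orP[/negP/eqP zx /negP/eqP zy].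
    case: nt => z0; apply; exact: (mobius_fix3 dg.1 xy (nesym zx) (nesym zy)).
  by case=> /eqP ->; apply: val_inj; rewrite /= h.
(* The group acts freely on the fibre over [w], whose d^k points therefore split into orbits of size
   #|G|. *)
have Ndk : (#|G| %| d ^ k)%N.
  pose S1 : {set seq_sub Y} := [set y | gk (ssval y) == w].
  have cS : #|S1| = (d ^ k)%N.
    rewrite -s cardE -(size_map (@ssval _ Y)); apply/perm_size/uniq_perm => //.
      by rewrite map_inj_uniq ?enum_uniq //; apply: val_inj.
    move=> y; rewrite m; apply/mapP/eqP => [[z]|e].
      by rewrite mem_enum inE => /eqP <- ->.
    have yY : y \in Y by apply: lY; rewrite m e.
    by exists (SeqSub yY); rewrite // mem_enum inE /= e.
  have aS : [acts G, on S1 | 'P].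
    apply/actsP => sg /deck_permsP[tg [[_ dg] h]] y.
    by rewrite !inE /= /aperm h dg.
  rewrite -cS -(acts_sum_card_orbit aS); apply: dvdn_sum => O /imsetP[y yS ->].
  suff -> : #|orbit 'P G y| = #|G| by [].
  rewrite -(card_orbit_stab 'P G y) (_ : 'C_G[y | 'P]%g = 1%g) ?cards1 ?muln1 //.
  apply/trivgP/subsetP => sg; rewrite inE => /andP[sG /astab1P hy]; rewrite inE.
  apply: contraT => s1; case/deck_permsP: (sG) => tg [dg h].
  have fy : tg (ssval y) = ssval y by rewrite -h -[in RHS]hy.
  move: wX; rewrite -(eqP (_ : gk (ssval y) == w)); last by move: yS; rewrite inE.
  by rewrite map_f // (hX tg) //; apply: nontriv h s1.
(* The d rotations about the axis fix both a and b; their values at [M1 (Some 1)] tell them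
   apart. *)
have stab (c : seq_sub Y) : (ssval c = a \/ ssval c = b) -> (d <= #|'C_G[c | 'P]%g|)%N.
  move=> hc; have [rs [urs srs mrs]] := roots_of_unity C d0.
  have ex w0 : exists sg : {perm seq_sub Y}, w0 \in rs -> sg \in 'C_G[c | 'P]%g /\
      exists t, [/\ is_mobius t, induced t sg & t (M1 (Some 1)) = M1 (Some w0)].
    have [wr|] := boolP (w0 \in rs); last by exists 1%g.
    have /eqP hw : w0 ^+ d == 1 by rewrite -mrs.
    have [t1 [h1 gt ta tb t1w]] := rotation_exists hw.
    have dt := rotation_deck k0 h1 gt.
    have [sg hsg] := deck_perm Ysat dt; exists sg => _; split; last first.
      by exists t1; rewrite t1w mulr1.
    rewrite inE; apply/andP; split; first by apply/deck_permsP; exists t1.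
    by apply/astab1P/val_inj; rewrite /= /aperm hsg; case: hc => ->.
  have [F hF] := choice ex.
  have uF : uniq (map F rs).
    rewrite map_inj_in_uniq // => w1 w2 /hF[_ [t1 [h1 i1 e1]]] /hF[_ [t2 [h2 i2 e2]]] eF.
    have e12 : t1 =1 t2.
      by apply: eqY => // y yY; rewrite -(i1 (SeqSub yY)) eF i2.
    by have := e12 (M1 (Some 1)); rewrite e1 e2 => /inj1[].
  rewrite -srs -(size_map F) -(card_uniqP uF); apply/subset_leq_card/subsetP => sg.
  by case/mapP => w0 /hF[h _] ->.
have [sg hsg] := deck_perm Ysat ht.
have sG : sg \in G by apply/deck_permsP; exists t.
have axis (c e : seq_sub Y) : c != e -> (ssval c = a \/ ssval c = b) ->
    (ssval e = a \/ ssval e = b) -> t (ssval c) = ssval c \/ t (ssval c) = ssval e.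
  move=> ce /stab dc /stab de; rewrite -hsg.
  have pd p' : prime p' -> (p' %| #|G| -> p' %| d)%N.
    by move=> pp h; have := dvdn_trans h Ndk; rewrite Euclid_dvdX // => /andP[].
  by case: (axis_invariant ce d3 pd fix2 dc de sG) => ->; auto.
have nab : SeqSub aY != SeqSub bY by apply/eqP => -[] /critpoints_neq.
split; first by apply: (axis (SeqSub aY) (SeqSub bY)); auto.
by apply: (axis (SeqSub bY) (SeqSub aY)); rewrite 1?eq_sym; auto.
Qed.

(** A map swapping a and b would be an involution, so both are fixed; a third fixed point would make
    the map the identity. *)
Lemma deck_fixpoints t : deck k t -> order_ge3 t -> forall z, t z = z <-> (z = a \/ z = b).
Proof.
move=> dt [[z1 n1] [z2 n2]]; have [ht _] := dt; have ij := is_mobius_inj ht.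
have [[ta|ta] [tb|tb]] := deck_axis dt.
- move=> z; split=> [hz|[]->] //; apply: contrapT => /not_orP[za zb]; apply: n1.
  exact: (mobius_fix3 ht critpoints_neq (nesym za) (nesym zb)).
- by case: critpoints_neq; apply: ij; rewrite ta tb.
- by case: critpoints_neq; apply: ij; rewrite ta tb.
- by case: n2; apply: (mobius_swap ht critpoints_neq).
Qed.

End Deck.
End Unicritical.

Theorem mainTheorem5 (R : realType) (F f : ratmap R[i]) (k : nat) :
  bicritical f -> (3 <= rdeg f)%N -> (1 <= k)%N ->
  (forall z, reval F z = iter k (reval f) z) ->
  ((forall tau, in_deck F tau -> order_ge3 tau ->
      forall z, tau z = z <-> is_crit f z)
   /\ (exists tau, in_deck F tau /\ order_ge3 tau))
  /\ (forall x, is_critval f x <->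
        (forall y, reval F y = x -> is_crit F y)).
Proof.
move=> [a [b [ab hc]]] d3 k0 hF.
have d0 : (0 < rdeg f)%N by apply: leq_trans d3.
have [M1 [M2 [h1 h2 ea eb hg]]] := bicritical_normal_form d0 ab hc.
have deckE tau : in_deck F tau <-> deck (reval f) k tau.
  by split=> -[ht e]; split=> // z; move: (e z); rewrite !hF.
split; first split.
- move=> tau /deckE dt ot z; rewrite hc -ea -eb.
  exact: (deck_fixpoints d3 h1 h2 hg k0 dt ot).
- have [tau [dt ot]] := deck_order_ge3 d3 h1 hg k0.
  by exists tau; split=> //; apply/deckE.
move=> x; have -> : is_critval f x <-> x = M2 (Some 0) \/ x = M2 None.
  have ga := g_a d3 hg; have gb := g_b hg; rewrite -ga -gb ea eb.
  split=> [[z /hc[] -> <-]|[]->]; [by left|by right|by exists a; rewrite ?hc; auto|].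
  by exists b; rewrite ?hc; auto.
rewrite (critical_values_of_iterate d3 h1 h2 hg _ k0).
split=> H y e.
  have [j jk hj] : exists2 j, (j < k)%N &
    iter j (reval f) y = M1 (Some 0) \/ iter j (reval f) y = M1 None.
    by apply: H; rewrite -hF.
  by apply/(is_crit_iter _ d0 hF); exists j => //; rewrite hc -ea -eb.
have [j jk hj] : exists2 j, (j < k)%N & is_crit f (iter j (reval f) y).
  by apply/(is_crit_iter _ d0 hF)/H; rewrite hF.
by exists j => //; rewrite ea eb -hc.
Qed.
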